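(* For all integers $b\ge2$ and all positive integers $n$, $$\overline{\overline{\bigl((b+1)n\bigr)\ominus_b n}} = n\oplus_{-b}(-n).$$ In particular, for $b=2$: $n\oplus(3n)=n\oplus_{-2}(-n)$, where $\oplus$ is bitwise exclusive or.
   Context: Let $x\bmod b$ denote the unique $r$ with $0\le r<b$ and $b\mid x-r$. For non-negative integers $\alpha=\sum_{i\ge0}a_ib^i$, $\beta=\sum_{i\ge0}b_ib^i$ with digits $a_i,b_i\in\{0,\dots,b-1\}$, define $\alpha\ominus_b\beta=\sum_{i\ge0}\bigl((a_i-b_i)\bmod b\bigr)b^i$, and define $\overline{\overline{\alpha}}=\sum_{i\ge0}\min(a_i,1)b^i$ (every nonzero base-$b$ digit replaced by $1$). Every integer $\alpha$ can be written uniquely as $\alpha=\sum_{i\ge0}a_i(-b)^i$ with $a_i\in\{0,\dots,b-1\}$, finitely many nonzero; for integers $\alpha=\sum a_i(-b)^i$, $\beta=\sum b_i(-b)^i$ written this way, define $\alpha\oplus_{-b}\beta=\sum_{i\ge0}\bigl((a_i+b_i)\bmod b\bigr)b^i$. *)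

(* Defs.v *)
From mathcomp Require Import all_boot all_order all_algebra.
From mathcomp Require Import zify.
Import Order.TTheory GRing.Theory Num.Theory.

Set Implicit Arguments.
Unset Strict Implicit.
Unset Printing Implicit Defensive.

Local Open Scope nat_scope.

(* The i-th digit of x in base c, where c is b or -b; [modz] is the Euclidean
   remainder, so digits lie in {0, ..., b-1} for both signs of c.  For c = b
   this is meant for x >= 0 only.  The lemmas below show that the digits are
   eventually 0, that they represent x, and that they are the only ones. *)
Fixpoint digit (c x : int) (i : nat) : nat :=
  if i is j.+1 then digit c (x %/ c)%Z j else `|(x %% c)%Z|.

Lemma digit_lt (b : nat) (c x : int) i : 0 < b -> `|c| = b -> digit c x i < b.
Proof.
move=> b0 cb; elim: i x => [|i IH] x /=; last exact: IH.
have c0 : c != 0%R by rewrite -absz_gt0 cb.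
have := modz_ge0 x c0; have := ltz_mod x c0; lia.
Qed.

Lemma iter_divz_eq0 (c x : int) i :
  1 < `|c| -> (c < 0)%R || (0 <= x)%R -> `|x|.+2 <= i ->
  iter i (fun z => (z %/ c)%Z) x = 0%R.
Proof.
have Z k : iter k (fun z => (z %/ c)%Z) 0%R = 0%R.
  by elim: k => //= k ->; rewrite div0z.
move=> c1 cx xi; suff H k y : (c < 0)%R || (0 <= y)%R ->
    `|y| + (y != 1%R) <= k -> iter k (fun z => (z %/ c)%Z) y = 0%R.
  by apply: H => //; case: (x != 1%R); lia.
elim: k y => [|k IH] y cy yk; first by case: eqP yk => /= [->|_]; lia.
have c0 : c != 0%R by rewrite -absz_gt0; lia.
have r0 := modz_ge0 y c0; have r1 := ltz_mod y c0; have e := divz_eq y c.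
have [->|y0] := eqVneq y 0%R; first exact: Z.
have cq : (c < 0)%R || (0 <= (y %/ c)%Z)%R.
  case: (ltrP c 0) => //= c_ge0; rewrite divz_ge0 //; lia.
rewrite iterSr; have [->|q0] := eqVneq (y %/ c)%Z 0%R; first exact: Z.
apply: IH => //; clear Z.
move: (y %/ c)%Z (y %% c)%Z r0 r1 e cq q0 => q r r0 r1 e cq q0.
have [qy|[qy yE]] : `|q| < `|y| \/ q = 1%R /\ y = (-1)%R.
- have qc : (q * c)%R = (y - r)%R by rewrite e addrK.
  have aqc : `|q| * `|c| = `|(y - r)%R| by rewrite -abszM qc.
  have q2 : `|q| + `|c| <= (`|q| * `|c|).+1 by nia.
  have q3 : 2 * `|q| <= `|q| * `|c| by nia.
  have q4 : (`|q| - 1) * 2 + `|c| <= `|q| * `|c| by nia.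
  have [y_ge0|y_lt0] := lerP 0%R y.
    left; case: (lerP 0%R (y - r)%R) => h; lia.
  have := qc; case: (ltrP c 0) cq => //= c_lt0 cq; nia.
- by case: (q != 1%R); case: (y =P 1%R) yk => [yy|_] /=; first case: (ltrP q 0) => hq; nia.
by rewrite qy yE /= in yk *; lia.
Qed.

Lemma digitE (c x : int) i :
  digit c x i = `|(iter i (fun z => (z %/ c)%Z) x %% c)%Z|.
Proof. by elim: i x => [//|i IH] x; rewrite iterSr /= IH. Qed.

Lemma digit_eq0 (c x : int) i :
  1 < `|c| -> (c < 0)%R || (0 <= x)%R -> `|x|.+2 <= i -> digit c x i = 0.
Proof. by move=> c1 cx xi; rewrite digitE iter_divz_eq0 ?mod0z. Qed.

Lemma digit_sum (b : nat) (c x : int) m :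
  1 < b -> c = Posz b /\ (0 <= x)%R \/ c = (- b%:Z)%R -> `|x|.+2 <= m ->
  x = (\sum_(i < m) (digit c x i)%:Z * c ^+ i)%R.
Proof.
move=> b1 hc xm.
have c1 : 1 < `|c| by case: hc => [[-> _]|->]; lia.
have cx : (c < 0)%R || (0 <= x)%R by lia.
have c0 : c != 0%R by rewrite -absz_gt0; lia.
have H k y : y = (\sum_(i < k) (digit c y i)%:Z * c ^+ i
                 + iter k (fun z => (z %/ c)%Z) y * c ^+ k)%R.
  elim: k y => [|k IH] y; first by rewrite big_ord0 add0r mulr1.
  rewrite big_ord_recl iterSr /= expr0 mulr1.
  under eq_bigr => i _ do rewrite /bump /= add1n exprS mulrCA.
  rewrite -mulr_sumr exprS mulrCA -addrA -mulrDr -IH.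
  have := divz_eq y c; have := modz_ge0 y c0.
  by rewrite mulrC; lia.
by rewrite {1}(H m x) iter_divz_eq0 ?mul0r ?addr0.
Qed.

Lemma digit_uniq (b : nat) (c x : int) (a : nat -> nat) m :
  0 < b -> `|c| = b -> (forall i, a i < b) ->
  x = (\sum_(i < m) (a i)%:Z * c ^+ i)%R ->
  forall i, i < m -> a i = digit c x i.
Proof.
move=> b0 cb; elim: m x a => [//|m IH] x a ab xE i im.
have c0 : c != 0%R by rewrite -absz_gt0 cb.
pose q := (\sum_(i < m) (a i.+1)%:Z * c ^+ i)%R.
have xq : x = (q * c + (a 0)%:Z)%R.
  rewrite xE big_ord_recl /= expr0 mulr1 addrC; congr (_ + _)%R.
  rewrite /q mulr_suml; apply: eq_bigr => j _.
  by rewrite /bump /= add1n exprSr mulrA.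
have a0 : (0 <= (a 0)%:Z < `|c|)%R by rewrite -abszE cb lez_nat ltz_nat ab.
case: i im => [|i] im /=.
  by rewrite xq modzMDl -modz_abs modz_small.
have -> : (x %/ c)%Z = q by rewrite xq divzMDl // divz_small ?addr0.
exact: (IH q (fun i => a i.+1)).
Qed.

(* In the three sums below the bounds are chosen so that all omitted digits
   vanish by [digit_eq0]; they stand for the sums over all i >= 0. *)
Definition ominus (b alpha beta : nat) : nat :=
  \sum_(i < (alpha + beta).+2)
    `|(((digit b alpha i)%:Z - (digit b beta i)%:Z)%R %% b)%Z| * b ^ i.

Definition dbar (b alpha : nat) : nat :=
  \sum_(i < alpha.+2) minn (digit b alpha i) 1 * b ^ i.

Definition oplus_neg (b : nat) (alpha beta : int) : nat :=
  \sum_(i < (`|alpha| + `|beta|).+2)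
    (digit (- b%:Z)%R alpha i + digit (- b%:Z)%R beta i) %% b * b ^ i.

(* Main.v *)
Require Import Defs.
From mathcomp Require Import all_boot all_order all_algebra.
From mathcomp Require Import zify.
From Stdlib Require PeanoNat.
Import Order.TTheory GRing.Theory Num.Theory.

(** Let Q_i and X_i be the i-fold quotients of n and (b+1)n by b, and N_i and
    M_i those of n and -n by -b.  Then X_i = (b+1) Q_i + t_i with
    0 <= t_i <= b, so the i-th digit on the left is nonzero iff t_i is neither
    0 nor b; and N_i = (-1)^i (Q_i + s_i), N_i + M_i = e_i with s_i and e_i in
    {0, 1}, so the i-th digit on the right is e_i.  By induction on i, either
    e_i = 0 and t_i = b s_i, or e_i = 1, 0 < t_i < b and s_i = [i is even]. *)

Local Open Scope nat_scope.

(** The digit sums to be compared stop at different bounds; this brings them to a common one, so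
    that they can be compared term by term. *)
Lemma sum_ord_widen (m K : nat) (F : nat -> nat) :
  m <= K -> (forall i, m <= i -> F i = 0) ->
  \sum_(i < m) F i = \sum_(i < K) F i.
Proof.
move=> mK F0; rewrite (big_ord_widen K F mK) big_mkcond /=.
by apply: eq_bigr => i _; case: ltnP => // /F0.
Qed.

Lemma divz_modz_uniq {c x q r : int} :
  x = (q * c + r)%R -> (0 <= r < `|c|)%R -> (x %/ c)%Z = q /\ (x %% c)%Z = r.
Proof.
move=> -> hr; have c0 : c != 0%R by apply: contraTneq hr => ->; lia.
split; first by rewrite divzMDl // divz_small ?addr0.
by rewrite modzMDl -modz_abs modz_small.
Qed.

(* [o] is the parity of the position. *)
Definition quotients_rel (b : nat) (o : bool) (X Q N M : int) : Prop :=
  exists (t : nat) (s e : bool),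
    [/\ X = ((b%:Z + 1) * Q + t%:Z)%R,
        N = (if o then - (Q + s%:Z) else Q + s%:Z)%R,
        M = (e%:Z - N)%R &
        if e then 0 < t < b /\ s = ~~ o else t = b * s].

Lemma quotients_rel_div (b : nat) (o : bool) (X Q N M : int) :
  1 < b -> quotients_rel b o X Q N M ->
  quotients_rel b (~~ o) (X %/ b)%Z (Q %/ b)%Z
    (N %/ - b%:Z)%Z (M %/ - b%:Z)%Z.
Proof.
move=> b1 [t [s [e [XE NE ME te]]]].
have b0 : Posz b != 0%R by lia.
have /= [r_ge0 r_lt] := (modz_ge0 Q b0, ltz_mod Q b0).
have QE := divz_eq Q b.
move: (Q %/ b)%Z (Q %% b)%Z r_ge0 r_lt QE => q [] // r _ r_lt QE.
have {}r_lt : r < b by lia.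
have tb : t <= b by case: e te {ME} => [[]|->]; [lia | case: s {NE} => /=; lia].
(* With Q = qb + r, X = b((b+1)q + r) + (r + t) and r + t < 2b, so [k] is the carry and r + [k] the
   next t. *)
pose k : bool := b <= r + t.
(* Dividing N by -b amounts to rounding (r + s)/b down for even positions and up for odd ones; [s']
   is the result and [a] the digit of N. *)
pose s' : bool := if o then 0 < r + s else b <= r + s.
pose a := (if o then b%:Z * s'%:Z - r%:Z - s%:Z
           else r%:Z + s%:Z - b%:Z * s'%:Z)%R.
have a_bnd : (0 <= a < b%:Z)%R.
  rewrite /a /s'; clear - r_lt b1; case: o; case: s => /=.
  - by rewrite addn1 /=; lia.
  - by case: (posnP (r + 0)) => /= ?; lia.
  - by case: leqP => /= ?; lia.
  - by case: leqP => /= ?; lia.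
(* As M = (-N')(-b) + (e - a), the digit of M needs an added b exactly when e < a; base -b turns
   this borrow into +1 in the quotient. *)
pose e' : bool := (e%:Z < a)%R.
pose N' := (if o then q + s'%:Z else - (q + s'%:Z))%R.
have [-> _] : (X %/ b)%Z = ((b%:Z + 1) * q + (r + k)%:Z)%R
    /\ (X %% b)%Z = (r%:Z + t%:Z - b%:Z * k%:Z)%R.
  apply: divz_modz_uniq; first by rewrite XE QE; nia.
  by rewrite /k; case: leqP => /= ?; lia.
have [-> _] : (N %/ - b%:Z)%Z = N' /\ (N %% - b%:Z)%Z = a.
  apply: divz_modz_uniq; last by lia.
  by rewrite NE QE /N' /a; clear; move: (s') => u; case: (o) => /=; nia.
have NaE : N = (N' * - b%:Z + a)%R.
  by rewrite NE QE /N' /a; clear; move: (s') => u; case: (o) => /=; nia.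
have [-> _] : (M %/ - b%:Z)%Z = (e'%:Z - N')%R
    /\ (M %% - b%:Z)%Z = (e%:Z - a + b%:Z * e'%:Z)%R.
  apply: divz_modz_uniq; first by rewrite ME NaE; nia.
  by rewrite /e'; clear - a_bnd b1; case: e; case: ltrP => /= ?; lia.
exists (r + k), s', e'; split => //; first by rewrite /N'; case: (o).
move: te; rewrite /e' /a /s' /k; clear - r_lt b1.
by case: e => [[tb ->]|->]; case: o; try case: s => /=;
  repeat (case: ltrP => /= ?); repeat (case: ltnP => /= ?);
  repeat split; nia.
Qed.

Lemma quotients_rel_digit (b : nat) (o : bool) (X Q N M : int) :
  1 < b -> quotients_rel b o X Q N M ->
  minn `|((`|(X %% b)%Z|%:Z - `|(Q %% b)%Z|%:Z)%R %% b)%Z| 1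
  = (`|(N %% - b%:Z)%Z| + `|(M %% - b%:Z)%Z|) %% b.
Proof.
move=> b1 [t [s [e [XE NE ME te]]]].
have b0 : Posz b != 0%R by lia.
have c0 : (- b%:Z)%R != 0%R by lia.
(* X - Q = bQ + t, so the digit difference is t mod b. *)
have -> : minn `|((`|(X %% b)%Z|%:Z - `|(Q %% b)%Z|%:Z)%R %% b)%Z| 1 = e.
  rewrite !abszE !ger0_norm ?modz_ge0 // modzDml.
  rewrite -modzDmr modzNm modzDmr XE.
  have -> : ((b%:Z + 1) * Q + t%:Z - Q = Q * b%:Z + t%:Z)%R by lia.
  rewrite modzMDl modz_nat absz_nat.
  case: e te {ME} => [[tb _]|->]; last by rewrite modnMr.
  by rewrite modn_small; lia.
apply/esym.
(* The two digits are congruent to N and M modulo b, N + M = e, and e < b. *)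
suff : (`|(N %% - b%:Z)%Z| + `|(M %% - b%:Z)%Z|)%:Z = e%:Z %[mod b]%Z.
  by rewrite !modz_nat => -[->]; rewrite modn_small //; case: (e); lia.
rewrite PoszD !abszE !ger0_norm ?modz_ge0 // !modzN.
by rewrite modzDml modzDmr ME addrC subrK.
Qed.

Lemma quotients_rel_digits (b : nat) (i : nat) (o : bool) (X Q N M : int) :
  1 < b -> quotients_rel b o X Q N M ->
  minn `|(((digit b X i)%:Z - (digit b Q i)%:Z)%R %% b)%Z| 1
  = (digit (- b%:Z)%R N i + digit (- b%:Z)%R M i) %% b.
Proof.
move=> b1; elim: i o X Q N M => [|i IH] o X Q N M H /=.
  exact: quotients_rel_digit H.
exact: IH (quotients_rel_div _ _ _ _ _ _ b1 H).
Qed.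

Lemma digit_nat_eq0 (b x i : nat) : 1 < b -> x.+2 <= i -> digit b x i = 0.
Proof. by move=> b1 xi; apply: digit_eq0; lia. Qed.

Lemma ominus_sum (b x y K : nat) : 1 < b -> (x + y).+2 <= K ->
  ominus b x y =
  \sum_(i < K) `|(((digit b x i)%:Z - (digit b y i)%:Z)%R %% b)%Z| * b ^ i.
Proof.
move=> b1 hK; rewrite /ominus.
apply: (@sum_ord_widen _ _ (fun i => `|(((digit b x i)%:Z
  - (digit b y i)%:Z)%R %% b)%Z| * b ^ i)) => // i hi.
by rewrite !digit_nat_eq0 ?subrr ?mod0z //; lia.
Qed.

Lemma digit_ominus (b x y i : nat) : 1 < b ->
  digit b (ominus b x y) i
  = `|(((digit b x i)%:Z - (digit b y i)%:Z)%R %% b)%Z|.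
Proof.
move=> b1; apply/esym.
(* The bound passes every nonzero digit of [x] and [y] and also exceeds [i]. *)
apply: (@digit_uniq b b _ (fun i => `|(((digit b x i)%:Z
  - (digit b y i)%:Z)%R %% b)%Z|) ((x + y).+2 + i.+1)) => //; try lia.
rewrite (@ominus_sum b x y ((x + y).+2 + i.+1)) ?leq_addr //.
rewrite -[LHS]natz natr_sum; apply: eq_bigr => j _.
by rewrite natrM natrX !natz.
Qed.

Lemma dbar_sum (b x K : nat) : 1 < b -> x.+2 <= K ->
  dbar b x = \sum_(i < K) minn (digit b x i) 1 * b ^ i.
Proof.
move=> b1 hK; rewrite /dbar.
apply: (@sum_ord_widen _ _ (fun i => minn (digit b x i) 1 * b ^ i)) => // i hi.
by rewrite digit_nat_eq0 // min0n.
Qed.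

Lemma oplus_neg_sum (b K : nat) (x y : int) : 1 < b -> (`|x| + `|y|).+2 <= K ->
  oplus_neg b x y =
  \sum_(i < K) (digit (- b%:Z)%R x i + digit (- b%:Z)%R y i) %% b * b ^ i.
Proof.
move=> b1 hK; rewrite /oplus_neg.
apply: (@sum_ord_widen _ _ (fun i => (digit (- b%:Z)%R x i
  + digit (- b%:Z)%R y i) %% b * b ^ i)) => // i hi.
by rewrite !digit_eq0 ?mod0n //; lia.
Qed.

Lemma dbar_ominus (b n : nat) : 1 < b ->
  dbar b (ominus b ((b + 1) * n) n) = oplus_neg b n%:Z%R (- n%:Z)%R.
Proof.
move=> b1; set O := ominus _ _ _.
rewrite (@dbar_sum b O (O + (n + n)).+2) ?(@oplus_neg_sum b (O + (n + n)).+2) //; try lia.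
apply: eq_bigr => i _; congr (_ * _); rewrite digit_ominus //.
apply: (@quotients_rel_digits _ _ false) => //.
(* At position 0, X = (b+1)n, Q = N = n and M = -n, so t, s and e all vanish. *)
by exists 0, false, false; split; rewrite //= ?muln0 //; lia.
Qed.

Lemma nat_digit_sum (b x K : nat) : 1 < b -> x.+2 <= K ->
  x = \sum_(i < K) digit b x i * b ^ i.
Proof.
move=> b1 hK; apply/eqP; rewrite -eqz_nat; apply/eqP.
rewrite [LHS](@digit_sum b b _ K) //; last by left.
rewrite -[RHS]natz natr_sum; apply: eq_bigr => j _.
by rewrite natrM natrX !natz.
Qed.

(** Binary digits are at most 1 already. *)
Lemma dbar2 (x : nat) : dbar 2 x = x.
Proof.
rewrite [RHS](@nat_digit_sum 2 x x.+2) //; apply: eq_bigr => i _.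
congr (_ * _); have := @digit_lt 2 (Posz 2) x i isT erefl; lia.
Qed.

Lemma digit2_testbit (x i : nat) : digit (Posz 2) x i = Nat.testbit x i.
Proof.
elim: i x => [|i IH] x.
  rewrite PeanoNat.Nat.bit0_odd [LHS]/= modz_nat absz_nat modn2; congr nat_of_bool.
  by elim: x => // x IH; rewrite PeanoNat.Nat.odd_succ -PeanoNat.Nat.negb_odd -IH.
rewrite [LHS]/= divz_nat IH; congr (nat_of_bool (Nat.testbit _ i)).
rewrite divn2.
(* [Nat.div2] recurses two steps at a time, so two consecutive values are carried through the
   induction. *)
have half_div2 m : half m = Nat.div2 m /\ half m.+1 = Nat.div2 m.+1.
  by elim: m => // m [IHm IHm1]; split => //=; rewrite IHm.
by case: (half_div2 x).
Qed.

(** Subtraction modulo 2 of bits is exclusive or; the arguments are swapped to fit the order in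
    [theorem1]. *)
Lemma ominus2_lxor (x y : nat) : ominus 2 x y = Nat.lxor y x.
Proof.
set L := Nat.lxor y x; pose K := (L + (x + y)).+2.
rewrite (@nat_digit_sum 2 L K) ?(@ominus_sum 2 x y K) ?/K //; try lia.
apply: eq_bigr => i _; congr (_ * _).
rewrite !digit2_testbit /L PeanoNat.Nat.lxor_spec.
by case: Nat.testbit; case: Nat.testbit.
Qed.

Theorem theorem1 :
  (forall b n : nat, 2 <= b -> 0 < n ->
     dbar b (ominus b ((b + 1) * n) n) = oplus_neg b n%:Z%R (- n%:Z)%R)
  /\ (forall n : nat, 0 < n ->
     Nat.lxor n (3 * n) = oplus_neg 2 n%:Z%R (- n%:Z)%R).
Proof.
split=> [b n b2 _|n _]; first exact: dbar_ominus.
by rewrite -dbar_ominus // dbar2 ominus2_lxor.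
Qed.
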